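(* Let $x=(x_1,\dots,x_d)$ and $y=(y_1,\dots,y_d)$ be vectors in $I^d$, partitioned into $M$ subvectors $x_{i\cdot}=(x_{i1},\dots,x_{i\lceil d/M\rceil})$ and $y_{i\cdot}=(y_{i1},\dots,y_{i\lceil d/M\rceil})$, $1\le i\le M$, as described in the context. Then for every $1\le i\le M$, $$D_f(x_{i\cdot},y_{i\cdot})\le \alpha_x^{(i)}+\alpha_y^{(i)}+\beta_{yy}^{(i)}+\sqrt{\gamma_x^{(i)}\,\delta_y^{(i)}},$$ where $$\alpha_x^{(i)}=\sum_{j=1}^{\lceil d/M\rceil} f(x_{ij}),\qquad \alpha_y^{(i)}=-\sum_{j=1}^{\lceil d/M\rceil} f(y_{ij}),\qquad \beta_{yy}^{(i)}=\sum_{j=1}^{\lceil d/M\rceil} y_{ij}\,\frac{\partial f(y)}{\partial y_{ij}},$$ $$\gamma_x^{(i)}=\sum_{j=1}^{\lceil d/M\rceil} x_{ij}^2,\qquad \delta_y^{(i)}=\sum_{j=1}^{\lceil d/M\rceil}\left(\frac{\partial f(y)}{\partial y_{ij}}\right)^2 .$$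
   Context: Let $I\subseteq\mathbb{R}$ be an open interval and $f:I\to\mathbb{R}$ a differentiable convex function. The same letter $f$ denotes the separable extension to vectors $v=(v_1,\dots,v_m)\in I^m$ (any $m$): $f(v)=\sum_{j=1}^m f(v_j)$; thus $\frac{\partial f(v)}{\partial v_j}=f'(v_j)$. The Bregman distance between $u,v\in I^m$ is $D_f(u,v)=f(u)-f(v)-\langle\nabla f(v),u-v\rangle$. Let $d,M$ be positive integers with $M\le d$. A vector $x\in I^d$ is partitioned into $M$ subvectors of consecutive coordinates, $x_{i\cdot}=(x_{\lceil d/M\rceil(i-1)+1},\dots,x_{\lceil d/M\rceil i})=(x_{i1},\dots,x_{i\lceil d/M\rceil})$, $1\le i\le M$, and $y$ is partitioned in the same manner. If $M$ does not divide $d$, coordinates with index larger than $d$ are simply absent (the corresponding terms are omitted from all sums). *)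

(* Defs.v *)
From HB Require Import structures.
From mathcomp Require Import all_boot all_order all_algebra.
From mathcomp Require Import all_classical all_reals all_analysis.

Set Implicit Arguments.
Unset Strict Implicit.
Unset Printing Implicit Defensive.

Import Order.TTheory GRing.Theory Num.Theory.
Import numFieldNormedType.Exports.

Local Open Scope classical_set_scope.
Local Open Scope ring_scope.

(* A function on an open set I is represented by a total function R -> R that
   is only ever evaluated, and differentiated, at points of I. *)
Definition separable_ext (R : realType) (f : R -> R) (m : nat)
    (v : 'rV[R]_m) : R :=
  \sum_(j < m) f (v 0 j).
Arguments separable_ext {R} f {m} v.

Definition partial (R : realType) (m : nat) (g : 'rV[R]_m -> R)
    (v : 'rV[R]_m) (j : 'I_m) : R :=
  'D_(delta_mx 0 j) g v.

Definition gradient (R : realType) (m : nat) (g : 'rV[R]_m -> R)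
    (v : 'rV[R]_m) : 'rV[R]_m :=
  \row_(j < m) partial g v j.

Definition inner (R : realType) (m : nat) (u v : 'rV[R]_m) : R :=
  \sum_(j < m) u 0 j * v 0 j.

Definition bregman (R : realType) (f : R -> R) (m : nat)
    (u v : 'rV[R]_m) : R :=
  separable_ext f u - separable_ext f v
    - inner (gradient (separable_ext f) v) (u - v).

(* The ceiling of d / M, as a natural number; the ceiling is nonnegative, so
   the absolute value is only a cast. *)
Definition block_width (d M : nat) : nat :=
  `|Num.ceil (d%:R / M%:R : rat)|%N.

(* Blocks and coordinates are numbered from 0: coordinate j of block i is
   coordinate block_width d M * i + j of the full vector. Coordinates beyond
   the d-th are absent, so the last blocks may be shorter than block_width d M,
   or even empty (as for d = 5, M = 4, i = 3). *)
Definition block_size (d M : nat) (i : 'I_M) : nat :=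
  minn (block_width d M) (d - block_width d M * i).

Lemma block_index_subproof (d M : nat) (i : 'I_M) (j : 'I_(block_size d i)) :
  (block_width d M * i + j < d)%N.
Proof.
by have := ltn_ord j; rewrite leq_min => /andP[_]; rewrite ltn_subRL.
Qed.

Definition block_index (d M : nat) (i : 'I_M) (j : 'I_(block_size d i)) : 'I_d :=
  Ordinal (block_index_subproof j).

Definition subvector (R : realType) (d M : nat) (x : 'rV[R]_d) (i : 'I_M) :
    'rV[R]_(block_size d i) :=
  colsub (@block_index d M i) x.

(* Main.v *)
Require Import Defs.
From HB Require Import structures.
From mathcomp Require Import all_boot all_order all_algebra.
From mathcomp Require Import all_classical all_reals all_analysis.
From mathcomp Require Import ring.

Set Implicit Arguments.
Unset Strict Implicit.
Unset Printing Implicit Defensive.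

Import Order.TTheory GRing.Theory Num.Theory.
Import numFieldNormedType.Exports.

Local Open Scope classical_set_scope.
Local Open Scope ring_scope.

(* The Bregman distance expands to [alpha_x + alpha_y + beta_yy] minus the inner
   product of [x_i] with the gradient, and Cauchy-Schwarz bounds the latter. *)

(** Write g for the gradient at [yi]. Since -<g, xi - yi> = <yi, g> - <xi, g>, only -<xi, g> has to
    be estimated, and [sum_mul_le_sqrt] bounds it. By separability ([partial_separable_ext]), g
    consists of the partials of the full vector [y] on block [i]. *)

Lemma partial_separable_ext (R : realType) (f : R -> R) (m : nat)
    (v : 'rV[R]_m) (j : 'I_m) :
  partial (separable_ext f) v j = 'D_1 f (v 0 j).
Proof.
(* The two difference quotients coincide, not just their limits. *)
rewrite /partial /derive.
apply: (congr1 (fun q : R -> R => lim (q @ 0^'))); apply/funext => h /=.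
congr (_ *: _); rewrite /separable_ext -sumrB (bigD1 j) //= big1 ?addr0.
  by rewrite !mxE !eqxx.
by move=> k kj; rewrite !mxE (negbTE kj) andbF mulr0 add0r subrr.
Qed.

Lemma sum_cauchy_schwarz (R : realFieldType) (m : nat) (a b : 'I_m -> R) :
  (\sum_j a j * b j) ^+ 2 <= (\sum_j a j ^+ 2) * (\sum_j b j ^+ 2).
Proof.
(* The gap is doubled because a sum over all ordered pairs (j, k) counts each unordered pair
   twice. *)
rewrite -subr_ge0 -(pmulrn_lge0 _ (ltn0Sn 1)).
(* Lagrange's identity *)
suff -> : ((\sum_j a j ^+ 2) * (\sum_j b j ^+ 2) - (\sum_j a j * b j) ^+ 2) *+ 2
    = \sum_j \sum_k (a j * b k - a k * b j) ^+ 2.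
  by apply: sumr_ge0 => j _; apply: sumr_ge0 => k _; exact: sqr_ge0.
(* Swapping the factors in one of the two copies yields both a_j^2 b_k^2 and b_j^2 a_k^2, so the
   identity holds term by term. *)
rewrite mulrnBl mulr2n [X in _ + X - _]mulrC expr2 !big_distrlr /=.
rewrite -sumrMnl -big_split -sumrB /=; apply: eq_bigr => j _.
rewrite -sumrMnl -big_split -sumrB /=; apply: eq_bigr => k _.
ring.
Qed.

(** The absolute value matters: the inner product enters the Bregman distance with a minus sign. *)
Lemma sum_mul_le_sqrt (R : rcfType) (m : nat) (a b : 'I_m -> R) :
  `|\sum_j a j * b j| <= Num.sqrt ((\sum_j a j ^+ 2) * (\sum_j b j ^+ 2)).
Proof. by rewrite -sqrtr_sqr ler_wsqrtr // sum_cauchy_schwarz. Qed.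

Theorem theorem1 (R : realType) (I : set R) (f : R -> R)
  (I_open : open I) (I_itv : is_interval I)
  (f_diff : forall t : R, I t -> derivable f t 1)
  (f_convex : @convex_function R R^o I f)
  (d M : nat) (d_gt0 : (0 < d)%N) (M_gt0 : (0 < M)%N) (M_le_d : (M <= d)%N)
  (x y : 'rV[R]_d)
  (xI : forall k : 'I_d, I (x 0 k)) (yI : forall k : 'I_d, I (y 0 k))
  (i : 'I_M) :
  let xi := subvector x i in
  let yi := subvector y i in
  let dfy (j : 'I_(block_size d i)) :=
    partial (separable_ext f) y (block_index j) in
  let alpha_x := \sum_(j < block_size d i) f (xi 0 j) in
  let alpha_y := - \sum_(j < block_size d i) f (yi 0 j) in
  let beta_yy := \sum_(j < block_size d i) yi 0 j * dfy j in
  let gamma_x := \sum_(j < block_size d i) xi 0 j ^+ 2 in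
  let delta_y := \sum_(j < block_size d i) dfy j ^+ 2 in
  bregman f xi yi <=
    alpha_x + alpha_y + beta_yy + Num.sqrt (gamma_x * delta_y).
Proof.
cbv beta zeta; set xi := subvector x i; set yi := subvector y i.
pose dfy (j : 'I_(block_size d i)) :=
  partial (separable_ext f) y (block_index j).
(* Block and full vector share this coordinate, so both sides are the derivative of [f] at the same
   point. *)
have grad j : gradient (separable_ext f) yi 0 j = dfy j.
  by rewrite mxE /dfy !partial_separable_ext mxE.
have -> : bregman f xi yi
    = \sum_j f (xi 0 j) - \sum_j f (yi 0 j) + \sum_j yi 0 j * dfy j
      + - \sum_j xi 0 j * dfy j.
  rewrite /bregman /inner -[RHS]addrA; congr (_ + _); rewrite -sumrB -sumrN.
  apply: eq_bigr => j _; rewrite grad [(xi - yi) 0 j]mxE [(- yi) 0 j]mxE.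
  by ring.
rewrite lerD2l; apply: le_trans (ler_norm _) _.
by rewrite normrN; exact: sum_mul_le_sqrt.
Qed.
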